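(* Over $\mathsf{RCA}_0$, $\Sigma^0_2\text{-}\mathsf{IND}$ implies the Additive Ramsey Theorem.
   Context: $\mathsf{RCA}_0$: second-order arithmetic with $\Delta^0_1$-comprehension and $\Sigma^0_1$-induction. $\Sigma^0_2\text{-}\mathsf{IND}$: the induction scheme for $\Sigma^0_2$ formulae with parameters. Additive Ramsey Theorem: for every finite semigroup $(S,* )$ and every colouring $C:[\mathbb{N}]^2\to S$ of unordered pairs such that $C(i,j)*C(j,k)=C(i,k)$ for all $i<j<k$, there is an infinite set $I\subseteq\mathbb{N}$ and a colour $a\in S$ with $C(i,j)=a$ for all $i<j$ in $I$. *)

(* Defs.v *)
(* Semantic (model-theoretic) rendering of second-order
   arithmetic: an L2-structure is a first-order part (dom, 0, 1, +, *, <)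
   together with a second-order part [sets] (a collection of subsets of dom),
   as in Simpson, "Subsystems of Second Order Arithmetic", Def. I.2.4 / VIII. *)

Record L2str : Type := {
  dom  : Type;
  zero : dom;
  one  : dom;
  add  : dom -> dom -> dom;
  mul  : dom -> dom -> dom;
  lt   : dom -> dom -> Prop;
  sets : (dom -> Prop) -> Prop
}.

(* ---------- Syntax of L2 (de Bruijn indices) ---------- *)

Inductive term : Type :=
| Var   : nat -> term
| Zero  : term
| One   : term
| Plus  : term -> term -> term
| Times : term -> term -> term.

Inductive form : Type :=
| Eq   : term -> term -> form
| Lt   : term -> term -> form
| Mem  : term -> nat -> form          (* t ∈ X_k, set variable k *)
| Bot  : form
| Neg  : form -> form
| And  : form -> form -> form
| Or   : form -> form -> form
| Imp  : form -> form -> form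
| All  : form -> form                 (* ∀n, binds number variable 0 *)
| Ex   : form -> form
| BAll : term -> form -> form         (* ∀n < t; t is read outside the binder *)
| BEx  : term -> form -> form
| SAll : form -> form                 (* ∀X, binds set variable 0 *)
| SEx  : form -> form.

Definition scons {A : Type} (a : A) (e : nat -> A) : nat -> A :=
  fun n => match n with 0 => a | S k => e k end.

Fixpoint teval (M : L2str) (rho : nat -> dom M) (t : term) : dom M :=
  match t with
  | Var n => rho n
  | Zero => zero M
  | One => one M
  | Plus t u => add M (teval M rho t) (teval M rho u)
  | Times t u => mul M (teval M rho t) (teval M rho u)
  end.

Fixpoint sat (M : L2str) (rho : nat -> dom M) (sig : nat -> (dom M -> Prop))
  (phi : form) : Prop :=
  match phi with
  | Eq t u => teval M rho t = teval M rho u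
  | Lt t u => lt M (teval M rho t) (teval M rho u)
  | Mem t k => sig k (teval M rho t)
  | Bot => False
  | Neg p => ~ sat M rho sig p
  | And p q => sat M rho sig p /\ sat M rho sig q
  | Or p q => sat M rho sig p \/ sat M rho sig q
  | Imp p q => sat M rho sig p -> sat M rho sig q
  | All p => forall a, sat M (scons a rho) sig p
  | Ex p => exists a, sat M (scons a rho) sig p
  | BAll t p => forall a, lt M a (teval M rho t) -> sat M (scons a rho) sig p
  | BEx t p => exists a, lt M a (teval M rho t) /\ sat M (scons a rho) sig p
  | SAll p => forall X, sets M X -> sat M rho (scons X sig) p
  | SEx p => exists X, sets M X /\ sat M rho (scons X sig) p
  end.

Fixpoint bounded (phi : form) : Prop :=
  match phi with
  | Eq _ _ | Lt _ _ | Mem _ _ | Bot => True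
  | Neg p => bounded p
  | And p q | Or p q | Imp p q => bounded p /\ bounded q
  | BAll _ p | BEx _ p => bounded p
  | All _ | Ex _ | SAll _ | SEx _ => False
  end.

Definition isSigma01 (phi : form) : Prop := exists th, bounded th /\ phi = Ex th.
Definition isPi01    (phi : form) : Prop := exists th, bounded th /\ phi = All th.
Definition isSigma02 (phi : form) : Prop :=
  exists th, bounded th /\ phi = Ex (All th).

Definition good_senv (M : L2str) (sig : nat -> (dom M -> Prop)) : Prop :=
  forall n, sets M (sig n).

Definition basic_axioms (M : L2str) : Prop :=
  (forall m, add M m (one M) <> zero M) /\
  (forall m n, add M m (one M) = add M n (one M) -> m = n) /\
  (forall m, add M m (zero M) = m) /\
  (forall m n, add M m (add M n (one M)) = add M (add M m n) (one M)) /\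
  (forall m, mul M m (zero M) = zero M) /\
  (forall m n, mul M m (add M n (one M)) = add M (mul M m n) m) /\
  (forall m, ~ lt M m (zero M)) /\
  (forall m n, lt M m (add M n (one M)) <-> (lt M m n \/ m = n)).

Definition induction_instance (M : L2str) (phi : form) : Prop :=
  forall rho sig, good_senv M sig ->
    sat M (scons (zero M) rho) sig phi ->
    (forall a, sat M (scons a rho) sig phi -> sat M (scons (add M a (one M)) rho) sig phi) ->
    forall a, sat M (scons a rho) sig phi.

Definition Sigma01_IND (M : L2str) : Prop :=
  forall phi, isSigma01 phi -> induction_instance M phi.

Definition Sigma02_IND (M : L2str) : Prop :=
  forall phi, isSigma02 phi -> induction_instance M phi.

Definition Delta01_CA (M : L2str) : Prop :=
  forall phi psi, isSigma01 phi -> isPi01 psi ->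
  forall rho sig, good_senv M sig ->
    (forall a, sat M (scons a rho) sig phi <-> sat M (scons a rho) sig psi) ->
    exists X, sets M X /\ forall a, X a <-> sat M (scons a rho) sig phi.

Definition RCA0 (M : L2str) : Prop :=
  basic_axioms M /\ Sigma01_IND M /\ Delta01_CA M.

(* Cantor pairing used in RCA0: (i,j) = (i+j)^2 + i *)
Definition pairM (M : L2str) (i j : dom M) : dom M :=
  add M (mul M (add M i j) (add M i j)) i.

(* a finite semigroup is {a | a < k} with operation coded by the set O:
   a * b = c  iff  ((a,b),c) ∈ O;  a colouring is coded by the set C:
   C(i,j) = c  iff  ((i,j),c) ∈ C *)
Definition code3 (M : L2str) (Z : dom M -> Prop) (x y z : dom M) : Prop :=
  Z (pairM M (pairM M x y) z).

Definition AdditiveRamsey (M : L2str) : Prop :=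
  forall (k : dom M) (O C : dom M -> Prop), sets M O -> sets M C ->
  (forall a b, lt M a k -> lt M b k ->
     exists c, lt M c k /\ code3 M O a b c /\
       forall c', lt M c' k -> code3 M O a b c' -> c' = c) ->
  (forall a b c ab bc d, lt M a k -> lt M b k -> lt M c k ->
     lt M ab k -> lt M bc k -> lt M d k ->
     code3 M O a b ab -> code3 M O b c bc -> code3 M O ab c d ->
     code3 M O a bc d) ->
  (forall i j, lt M i j ->
     exists c, lt M c k /\ code3 M C i j c /\
       forall c', lt M c' k -> code3 M C i j c' -> c' = c) ->
  (forall i j l a b c, lt M i j -> lt M j l ->
     lt M a k -> lt M b k -> lt M c k ->
     code3 M C i j a -> code3 M C j l b -> code3 M C i l c ->
     code3 M O a b c) ->
  exists I, sets M I /\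
    (forall n, exists m, lt M n m /\ I m) /\
    exists a, lt M a k /\
      forall i j, I i -> I j -> lt M i j -> code3 M C i j a.

(* Main.v *)
(** Call x and y equivalent when C(x,m) = C(y,m) for some m; by additivity the
    equality then persists for all larger m.  By the pigeonhole principle there
    are at most k classes, so Sigma^0_2 induction gives a finite maximal system
    of pairwise inequivalent elements.  By Sigma^0_2 collection there are a
    representative z and a colour a such that J = {x > z : x ~ z, C(z,x) = a} is
    infinite, and J is Delta^0_1 because "x ~ z" is the negation of "x is
    equivalent to another representative".  The greedy set I, consisting of the
    y in J with C(i,y) = a for all smaller i in I, is homogeneous.  It is
    infinite: if I were bounded, then every sufficiently large y in J would
    satisfy C(i,y) = C(z,y) = a for all i in I and would have been added.

    Finite sets and sequences in the possibly nonstandard model M are coded by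
    divisibility, as with Goedel's beta function. *)

Require Import Defs.
From Stdlib Require Import List Classical Ring.
Import ListNotations.

Section Model.

Variable M : L2str.
Local Notation D := (dom M).

Declare Scope M_scope.
Delimit Scope M_scope with M.
Local Open Scope M_scope.
Local Notation "0" := (zero M) : M_scope.
Local Notation "1" := (one M) : M_scope.
Local Infix "+" := (add M) : M_scope.
Local Infix "*" := (mul M) : M_scope.
Local Infix "<" := (lt M) : M_scope.
Local Notation pr := (pairM M).

(** * Definability by bounded formulas with parameters *)

Definition cat (l : list D) (rho : nat -> D) : nat -> D := fold_right scons rho l.

Definition vals {G} (v : list (G -> D)) (g : G) : list D := map (fun f => f g) v.

(** The newest variable comes first because a binder gives it index 0. *)
Definition ext {G} (v : list (G -> D)) : list (G * D -> D) :=
  snd :: map (fun f p => f (fst p)) v.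

Definition covers {A} (l : list A) (e : nat -> A) : Prop :=
  forall c, In c l -> exists n, e n = c.

(* A context lists the bound variables as functions of an abstract [G]; any
   further element of the model is a parameter supplied by [rho]. *)
Definition TD {G} (v : list (G -> D)) (t : G -> D) : Prop :=
  exists ps, forall rho, covers ps rho ->
    exists tm, forall g, teval M (cat (vals v g) rho) tm = t g.

(* A predicate is definable once its parameters occur in the environments:
   keeping the environments arbitrary makes the closure under connectives a
   matter of appending parameter lists, without renaming. *)
Definition D0 {G} (v : list (G -> D)) (P : G -> Prop) : Prop :=
  exists ps Xs, Forall (sets M) Xs /\
    forall rho sig, covers ps rho -> covers Xs sig ->
      exists phi, bounded phi /\
        forall g, sat M (cat (vals v g) rho) sig phi <-> P g.

Lemma vals_ext {G} (v : list (G -> D)) g a : vals (ext v) (g, a) = a :: vals v g.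
Proof. unfold vals, ext; simpl; now rewrite map_map. Qed.

Lemma covers_app {A} (l1 l2 : list A) e :
  covers (l1 ++ l2) e -> covers l1 e /\ covers l2 e.
Proof. intros H; split; intros c Hc; apply H, in_or_app; auto. Qed.

Lemma cat_nth (l : list D) rho n : cat l rho (length l + n) = rho n.
Proof. induction l; simpl; auto. Qed.

Lemma TD_const {G} (v : list (G -> D)) (c : D) : TD v (fun _ => c).
Proof.
  exists [c]; intros rho H. destruct (H c) as [n Hn]; [now left|].
  (* Parameters lie behind the bound variables in the environment. *)
  exists (Var (length v + n)); intros g; simpl.
  replace (length v) with (length (vals v g)) by apply length_map.
  now rewrite cat_nth.
Qed.

Lemma TD_var {G} (v : list (G -> D)) f : In f v -> TD v f.
Proof.
  intros Hf; exists []; intros rho _.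
  enough (H : exists n, forall g, cat (vals v g) rho n = f g).
  { destruct H as [n Hn]; now exists (Var n). }
  induction v as [|h v IH]; [easy|].
  destruct Hf as [->|Hf]; [now exists O|].
  destruct (IH Hf) as [n Hn]; now exists (S n).
Qed.

Lemma TD_zero {G} (v : list (G -> D)) : TD v (fun _ => 0).
Proof. exists []; intros; now exists Zero. Qed.

Lemma TD_one {G} (v : list (G -> D)) : TD v (fun _ => 1).
Proof. exists []; intros; now exists One. Qed.

Lemma TD_add {G} (v : list (G -> D)) t u :
  TD v t -> TD v u -> TD v (fun g => t g + u g).
Proof.
  intros [p1 H1] [p2 H2]; exists (p1 ++ p2); intros rho [C1 C2]%covers_app.
  destruct (H1 rho C1) as [a Ha], (H2 rho C2) as [b Hb].
  exists (Plus a b); intros g; simpl; now rewrite Ha, Hb.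
Qed.

Lemma TD_mul {G} (v : list (G -> D)) t u :
  TD v t -> TD v u -> TD v (fun g => t g * u g).
Proof.
  intros [p1 H1] [p2 H2]; exists (p1 ++ p2); intros rho [C1 C2]%covers_app.
  destruct (H1 rho C1) as [a Ha], (H2 rho C2) as [b Hb].
  exists (Times a b); intros g; simpl; now rewrite Ha, Hb.
Qed.

Lemma TD_pair {G} (v : list (G -> D)) t u :
  TD v t -> TD v u -> TD v (fun g => pr (t g) (u g)).
Proof. intros Ht Hu; unfold pairM; auto using TD_add, TD_mul. Qed.

Fixpoint shift (t : term) : term :=
  match t with
  | Var n => Var (S n)
  | Zero => Zero
  | One => One
  | Plus t u => Plus (shift t) (shift u)
  | Times t u => Times (shift t) (shift u)
  end.

Lemma teval_shift a rho t : teval M (scons a rho) (shift t) = teval M rho t.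
Proof. induction t; simpl; congruence. Qed.

Lemma TD_weaken {G} (v : list (G -> D)) t :
  TD v t -> TD (ext v) (fun p => t (fst p)).
Proof.
  intros [ps H]; exists ps; intros rho C; destruct (H rho C) as [tm E].
  exists (shift tm); intros [g a]; rewrite vals_ext; simpl.
  now rewrite teval_shift.
Qed.

Lemma D0_eq {G} (v : list (G -> D)) t u :
  TD v t -> TD v u -> D0 v (fun g => t g = u g).
Proof.
  intros [p1 H1] [p2 H2]; exists (p1 ++ p2), []; split; [easy|].
  intros rho sig [C1 C2]%covers_app _.
  destruct (H1 rho C1) as [a Ha], (H2 rho C2) as [b Hb].
  exists (Eq a b); split; [easy|]; intros g; simpl; now rewrite Ha, Hb.
Qed.

Lemma D0_lt {G} (v : list (G -> D)) t u :
  TD v t -> TD v u -> D0 v (fun g => t g < u g).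
Proof.
  intros [p1 H1] [p2 H2]; exists (p1 ++ p2), []; split; [easy|].
  intros rho sig [C1 C2]%covers_app _.
  destruct (H1 rho C1) as [a Ha], (H2 rho C2) as [b Hb].
  exists (Lt a b); split; [easy|]; intros g; simpl; now rewrite Ha, Hb.
Qed.

Lemma D0_mem {G} (v : list (G -> D)) X t :
  sets M X -> TD v t -> D0 v (fun g => X (t g)).
Proof.
  intros HX [p1 H1]; exists p1, [X]; split; [now repeat constructor|].
  intros rho sig C1 C2.
  destruct (H1 rho C1) as [a Ha], (C2 X) as [k Hk]; [now left|].
  exists (Mem a k); split; [easy|]; intros g; simpl; now rewrite Ha, Hk.
Qed.

Lemma D0_not {G} (v : list (G -> D)) P : D0 v P -> D0 v (fun g => ~ P g).
Proof.
  intros (ps & Xs & HX & H); exists ps, Xs; split; [easy|].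
  intros rho sig C1 C2; destruct (H rho sig C1 C2) as (phi & B & Hphi).
  exists (Neg phi); split; [easy|]; intros g; simpl; now rewrite Hphi.
Qed.

Lemma D0_merge {G} (v : list (G -> D)) P Q : D0 v P -> D0 v Q ->
  exists ps Xs, Forall (sets M) Xs /\
    forall rho sig, covers ps rho -> covers Xs sig ->
      exists phi psi, bounded phi /\ bounded psi /\
        (forall g, sat M (cat (vals v g) rho) sig phi <-> P g) /\
        (forall g, sat M (cat (vals v g) rho) sig psi <-> Q g).
Proof.
  intros (p1 & X1 & HX1 & H1) (p2 & X2 & HX2 & H2).
  exists (p1 ++ p2), (X1 ++ X2); split; [now apply Forall_app|].
  intros rho sig [C1 C2]%covers_app [E1 E2]%covers_app.
  destruct (H1 rho sig C1 E1) as (phi & B1 & Hphi).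
  destruct (H2 rho sig C2 E2) as (psi & B2 & Hpsi).
  now exists phi, psi.
Qed.

Lemma D0_and {G} (v : list (G -> D)) P Q :
  D0 v P -> D0 v Q -> D0 v (fun g => P g /\ Q g).
Proof.
  intros HP HQ; destruct (D0_merge v P Q HP HQ) as (ps & Xs & HX & H).
  exists ps, Xs; split; [easy|]; intros rho sig C1 C2.
  destruct (H rho sig C1 C2) as (phi & psi & B1 & B2 & E1 & E2).
  exists (And phi psi); split; [easy|]; intros g; simpl; now rewrite E1, E2.
Qed.

Lemma D0_or {G} (v : list (G -> D)) P Q :
  D0 v P -> D0 v Q -> D0 v (fun g => P g \/ Q g).
Proof.
  intros HP HQ; destruct (D0_merge v P Q HP HQ) as (ps & Xs & HX & H).
  exists ps, Xs; split; [easy|]; intros rho sig C1 C2.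
  destruct (H rho sig C1 C2) as (phi & psi & B1 & B2 & E1 & E2).
  exists (Or phi psi); split; [easy|]; intros g; simpl; now rewrite E1, E2.
Qed.

Lemma D0_imp {G} (v : list (G -> D)) P Q :
  D0 v P -> D0 v Q -> D0 v (fun g => P g -> Q g).
Proof.
  intros HP HQ; destruct (D0_merge v P Q HP HQ) as (ps & Xs & HX & H).
  exists ps, Xs; split; [easy|]; intros rho sig C1 C2.
  destruct (H rho sig C1 C2) as (phi & psi & B1 & B2 & E1 & E2).
  exists (Imp phi psi); split; [easy|]; intros g; simpl; now rewrite E1, E2.
Qed.

Lemma D0_ball {G} (v : list (G -> D)) t (Q : G -> D -> Prop) :
  TD v t -> D0 (ext v) (fun p => Q (fst p) (snd p)) ->
  D0 v (fun g => forall a, a < t g -> Q g a).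
Proof.
  intros [p1 H1] (p2 & Xs & HX & H2); exists (p1 ++ p2), Xs; split; [easy|].
  intros rho sig [C1 C2]%covers_app E.
  destruct (H1 rho C1) as [u Hu], (H2 rho sig C2 E) as (phi & B & Hphi).
  exists (BAll u phi); split; [easy|]; intros g; simpl; rewrite Hu.
  split; intros H a Ha; specialize (H a Ha); specialize (Hphi (g, a));
    rewrite vals_ext in Hphi; now apply Hphi.
Qed.

Lemma D0_bex {G} (v : list (G -> D)) t (Q : G -> D -> Prop) :
  TD v t -> D0 (ext v) (fun p => Q (fst p) (snd p)) ->
  D0 v (fun g => exists a, a < t g /\ Q g a).
Proof.
  intros [p1 H1] (p2 & Xs & HX & H2); exists (p1 ++ p2), Xs; split; [easy|].
  intros rho sig [C1 C2]%covers_app E.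
  destruct (H1 rho C1) as [u Hu], (H2 rho sig C2 E) as (phi & B & Hphi).
  exists (BEx u phi); split; [easy|]; intros g; simpl; rewrite Hu.
  split; intros (a & Ha & H); exists a; (split; [easy|]);
    specialize (Hphi (g, a)); rewrite vals_ext in Hphi; now apply Hphi.
Qed.

(* Quantifying over all contexts and terms builds in closure under substitution. *)
Definition Def1 (P : D -> Prop) : Prop :=
  forall G (v : list (G -> D)) t, TD v t -> D0 v (fun g => P (t g)).
Definition Def2 (P : D -> D -> Prop) : Prop :=
  forall G (v : list (G -> D)) t1 t2, TD v t1 -> TD v t2 ->
    D0 v (fun g => P (t1 g) (t2 g)).
Definition Def3 (P : D -> D -> D -> Prop) : Prop :=
  forall G (v : list (G -> D)) t1 t2 t3, TD v t1 -> TD v t2 -> TD v t3 ->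
    D0 v (fun g => P (t1 g) (t2 g) (t3 g)).

Lemma covers_nth {A} (l : list A) d : covers l (fun n => nth n l d).
Proof.
  intros c Hc; destruct (In_nth l c d Hc) as (n & _ & Hn); now exists n.
Qed.

Lemma good_nth (Xs : list (D -> Prop)) X0 :
  sets M X0 -> Forall (sets M) Xs -> good_senv M (fun n => nth n Xs X0).
Proof.
  intros H0 H n; destruct (nth_in_or_default n Xs X0) as [Hn| ->]; [|easy].
  rewrite Forall_forall in H; now apply H.
Qed.

(** Contexts over a trivial base. In [v2] the outer variable is the argument and the inner one, of
    index 0, the quantified witness. *)
Definition v1 : list (unit * D -> D) := ext [].
Definition v2 : list (unit * D * D -> D) := ext v1.
Definition v3 : list (unit * D * D * D -> D) := ext v2.


(** * Automation for definability goals *)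

Ltac def_var := apply TD_var; simpl; repeat (first [left; reflexivity | right]).

Ltac weaken_exact H n :=
  first [ exact H
        | lazymatch n with S ?m => weaken_exact (TD_weaken _ _ H) m end ].

Ltac weaken_hyp :=
  match goal with H : TD _ _ |- _ => weaken_exact H 6 end.

(** A hook, redefined below as new predicates appear. *)
Ltac def_base := fail.

(** The shape of the goal selects the closure lemma, and higher-order patterns read off its subterms
    and subformulas. *)
Ltac def_step :=
  cbv beta;
  first
  [ progress intros
  | progress unfold code3, iff
  | def_base
  | lazymatch goal with
    | |- TD ?v (fun g => @?t g + @?u g) => apply (TD_add v t u)
    | |- TD ?v (fun g => @?t g * @?u g) => apply (TD_mul v t u)
    | |- TD _ (fun _ => 0) => apply TD_zero
    | |- TD _ (fun _ => 1) => apply TD_one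
    | |- TD ?v (fun _ => ?c) => apply (TD_const v c)
    | |- TD ?v (fun g => pr (@?t g) (@?u g)) => apply (TD_pair v t u)
    | |- TD _ _ => first [solve [def_var] | weaken_hyp]
    | H : Def1 ?Q |- D0 ?v (fun g => ?Q (@?a g)) => apply (H _ v a)
    | H : Def2 ?Q |- D0 ?v (fun g => ?Q (@?a g) (@?b g)) => apply (H _ v a b)
    | H : Def3 ?Q |- D0 ?v (fun g => ?Q (@?a g) (@?b g) (@?c g)) =>
        apply (H _ v a b c)
    | H : sets M ?X |- D0 ?v (fun g => ?X (@?t g)) => apply (D0_mem v X t H)
    | |- D0 ?v (fun g => @?P g /\ @?Q g) => apply (D0_and v P Q)
    | |- D0 ?v (fun g => @?P g \/ @?Q g) => apply (D0_or v P Q)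
    | |- D0 ?v (fun g => ~ @?P g) => apply (D0_not v P)
    | |- D0 ?v (fun g => @?t g = @?u g) => apply (D0_eq v t u)
    | |- D0 ?v (fun g => @?t g < @?u g) => apply (D0_lt v t u)
    | |- D0 ?v (fun g => forall a, a < @?t g -> @?Q g a) => apply (D0_ball v t Q)
    | |- D0 ?v (fun g => exists a, a < @?t g /\ @?Q g a) => apply (D0_bex v t Q)
    | |- D0 ?v (fun g => @?P g -> @?Q g) => apply (D0_imp v P Q)
    end ].

Ltac def := unfold Def1, Def2, Def3; repeat def_step.

(** * Induction and comprehension for definable predicates *)

Hypothesis HB : basic_axioms M.
Hypothesis HS1 : Sigma01_IND M.
Hypothesis HCA : Delta01_CA M.
Hypothesis HS2 : Sigma02_IND M.
(* The default value of the set environments. *)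
Variable X0 : D -> Prop.
Hypothesis HX0 : sets M X0.

Lemma ind_Sigma1 (Q : D -> D -> Prop) :
  D0 v2 (fun p => Q (snd (fst p)) (snd p)) ->
  (exists a, Q 0 a) ->
  (forall x, (exists a, Q x a) -> exists a, Q (x + 1) a) ->
  forall x, exists a, Q x a.
Proof.
  intros (ps & Xs & HX & H) Q0 QS.
  destruct (H (fun n => nth n ps 0) (fun n => nth n Xs X0)) as (phi & B & E);
    try apply covers_nth.
  set (rho := fun n => nth n ps 0) in *; set (sig := fun n => nth n Xs X0) in *.
  assert (E' : forall x, sat M (scons x rho) sig (Ex phi) <-> exists a, Q x a).
  { intros x; simpl; split; intros [a Ha]; exists a; now apply (E (tt, x, a)). }
  intros x; apply E'; apply HS1; [now exists phi|now apply good_nth| |].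
  - now apply E'.
  - intros a Ha; apply E', QS, E', Ha.
Qed.

(** A dummy existential quantifier makes the bounded formula $\Sigma^0_1$. *)
Lemma ind_D0 (P : D -> Prop) :
  D0 v2 (fun p => P (snd (fst p))) -> P 0 -> (forall x, P x -> P (x + 1)) ->
  forall x, P x.
Proof.
  intros HP H0 H1 x.
  destruct (ind_Sigma1 (fun x _ => P x) HP) with (x := x) as [_ H]; eauto.
  intros y [_ Hy]; exists 0; auto.
Qed.

Lemma ind_Sigma2 (Q : D -> D -> D -> Prop) :
  D0 v3 (fun p => Q (snd (fst (fst p))) (snd (fst p)) (snd p)) ->
  (exists a, forall b, Q 0 a b) ->
  (forall x, (exists a, forall b, Q x a b) -> exists a, forall b, Q (x + 1) a b) ->
  forall x, exists a, forall b, Q x a b.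
Proof.
  intros (ps & Xs & HX & H) Q0 QS.
  destruct (H (fun n => nth n ps 0) (fun n => nth n Xs X0)) as (phi & B & E);
    try apply covers_nth.
  set (rho := fun n => nth n ps 0) in *; set (sig := fun n => nth n Xs X0) in *.
  assert (E' : forall x, sat M (scons x rho) sig (Ex (All phi))
                         <-> exists a, forall b, Q x a b).
  { intros x; simpl; split; intros [a Ha]; exists a; intros b;
      apply (E (tt, x, a, b)), Ha. }
  intros x; apply E'; apply HS2; [now exists phi|now apply good_nth| |].
  - now apply E'.
  - intros a Ha; apply E', QS, E', Ha.
Qed.

(** [Q] and [R] supply the $\Sigma^0_1$ and $\Pi^0_1$ forms; both have to be read in one
    environment, hence [D0_merge]. *)
Lemma comprehension (P : D -> Prop) (Q R : D -> D -> Prop) :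
  D0 v2 (fun p => Q (snd (fst p)) (snd p)) ->
  D0 v2 (fun p => R (snd (fst p)) (snd p)) ->
  (forall x, P x <-> exists a, Q x a) ->
  (forall x, P x <-> forall a, R x a) ->
  exists X, sets M X /\ forall x, X x <-> P x.
Proof.
  intros HQ HR EQ ER.
  destruct (D0_merge _ _ _ HQ HR) as (ps & Xs & HX & H).
  destruct (H (fun n => nth n ps 0) (fun n => nth n Xs X0))
    as (phi & psi & B1 & B2 & E1 & E2); try apply covers_nth.
  set (rho := fun n => nth n ps 0) in *; set (sig := fun n => nth n Xs X0) in *.
  assert (E1' : forall x, sat M (scons x rho) sig (Ex phi) <-> P x).
  { intros x; rewrite EQ; simpl; split; intros [a Ha]; exists a;
      now apply (E1 (tt, x, a)). }
  assert (E2' : forall x, sat M (scons x rho) sig (All psi) <-> P x).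
  { intros x; rewrite ER; simpl; split; intros Ha a; apply (E2 (tt, x, a)), Ha. }
  destruct (HCA (Ex phi) (All psi)) with (rho := rho) (sig := sig)
    as (X & HX' & EX); [now exists phi|now exists psi|now apply good_nth| |].
  - intros a; etransitivity; [apply E1'|symmetry; apply E2'].
  - exists X; split; [easy|]; intros x; rewrite EX; apply E1'.
Qed.

(** * Semiring arithmetic and order *)

Lemma add_0_r m : m + 0 = m.
Proof. apply HB. Qed.

Lemma add_1_assoc m n : m + (n + 1) = m + n + 1.
Proof. apply HB. Qed.

Lemma mul_0_r m : m * 0 = 0.
Proof. apply HB. Qed.

Lemma mul_succ_r m n : m * (n + 1) = m * n + m.
Proof. apply HB. Qed.

Lemma succ_neq_0 m : m + 1 <> 0.
Proof. apply HB. Qed.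

Lemma succ_inj m n : m + 1 = n + 1 -> m = n.
Proof. apply HB. Qed.

Lemma nlt_0 m : ~ m < 0.
Proof. apply HB. Qed.

Lemma lt_succ m n : m < n + 1 <-> m < n \/ m = n.
Proof. apply HB. Qed.

Ltac induct x :=
  pattern x; apply ind_D0; clear x; [def| |].

Lemma add_0_l n : 0 + n = n.
Proof.
  induct n; [apply add_0_r|]; intros n IH; now rewrite add_1_assoc, IH.
Qed.

Lemma add_succ_l m n : m + 1 + n = m + n + 1.
Proof.
  induct n; [now rewrite !add_0_r|]; intros n IH; now rewrite !add_1_assoc, IH.
Qed.

Lemma add_comm m n : m + n = n + m.
Proof.
  induct n; [now rewrite add_0_r, add_0_l|].
  intros n IH; now rewrite add_1_assoc, add_succ_l, IH.
Qed.

Lemma add_assoc m n p : m + (n + p) = m + n + p.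
Proof.
  induct p; [now rewrite !add_0_r|]; intros p IH; now rewrite !add_1_assoc, IH.
Qed.

Lemma mul_0_l n : 0 * n = 0.
Proof.
  induct n; [apply mul_0_r|]; intros n IH; now rewrite mul_succ_r, IH, add_0_r.
Qed.

Lemma mul_succ_l m n : (m + 1) * n = m * n + n.
Proof.
  induct n; [now rewrite !mul_0_r, add_0_r|]; intros n IH.
  rewrite !mul_succ_r, IH, !add_1_assoc; f_equal.
  now rewrite <- !add_assoc, (add_comm n m).
Qed.

Lemma mul_comm m n : m * n = n * m.
Proof.
  induct n; [now rewrite mul_0_r, mul_0_l|].
  intros n IH; now rewrite mul_succ_r, mul_succ_l, IH.
Qed.

Lemma mul_add_l m n p : (m + n) * p = m * p + n * p.
Proof.
  induct p; [now rewrite !mul_0_r, add_0_r|]; intros p IH.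
  rewrite !mul_succ_r, IH, <- !add_assoc; f_equal.
  now rewrite !add_assoc, (add_comm m).
Qed.

Lemma mul_assoc m n p : m * (n * p) = m * n * p.
Proof.
  induct p; [now rewrite !mul_0_r|]; intros p IH.
  rewrite !mul_succ_r, <- IH, !(mul_comm m), mul_add_l; reflexivity.
Qed.

Lemma mul_1_l n : 1 * n = n.
Proof. rewrite <- (add_0_l 1), mul_succ_l, mul_0_l; apply add_0_l. Qed.

Lemma M_semiring : semi_ring_theory 0 1 (add M) (mul M) eq.
Proof.
  split; intros; auto using add_0_l, add_comm, add_assoc, mul_1_l, mul_0_l,
    mul_comm, mul_assoc, mul_add_l.
Qed.

Add Ring M_ring : M_semiring.

Lemma lt_add m z : m < m + (z + 1).
Proof.
  induct z; [rewrite add_0_l; apply lt_succ; auto|].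
  intros z IH; rewrite add_1_assoc; apply lt_succ; auto.
Qed.

Lemma lt_ex m n : m < n <-> exists z, n = m + (z + 1).
Proof.
  split; [|intros [z ->]; apply lt_add].
  (* With the quantifier pulled in front of the implication the claim is $\Sigma^0_1$ and open to
     induction. *)
  enough (H : exists z, m < n -> n = m + (z + 1)).
  { destruct H as [z Hz]; eauto. }
  pattern n; apply (ind_Sigma1 (fun n z => m < n -> n = m + (z + 1))); [def| |].
  - exists 0; intros H; now apply nlt_0 in H.
  - clear n; intros n [z Hz].
    destruct (classic (m < n)) as [H|H].
    + exists (z + 1); intros _; rewrite (Hz H) at 1; ring.
    + exists 0; intros [H'|H']%lt_succ; [easy|subst; ring].
Qed.

Lemma add_cancel_r m n p : m + p = n + p -> m = n.
Proof.
  induct p; [now rewrite !add_0_r|]; intros p IH H.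
  apply IH, succ_inj; now rewrite <- !add_1_assoc.
Qed.

Lemma zero_or_succ n : n = 0 \/ exists m, n = m + 1.
Proof.
  enough (H : exists m, n = 0 \/ n = m + 1) by (destruct H as [m []]; eauto).
  pattern n; apply (ind_Sigma1 (fun n m => n = 0 \/ n = m + 1)); [def| |].
  - exists 0; auto.
  - intros x _; exists x; auto.
Qed.

Lemma lt_irrefl n : ~ n < n.
Proof.
  intros [z Hz]%lt_ex; apply (succ_neq_0 z), (add_cancel_r _ _ n).
  rewrite Hz at 2; ring.
Qed.

Lemma lt_trans m n p : m < n -> n < p -> m < p.
Proof.
  intros [a ->]%lt_ex [b ->]%lt_ex; apply lt_ex; exists (a + b + 1); ring.
Qed.

Lemma lt_0_succ n : 0 < n + 1.
Proof. apply lt_ex; exists n; ring. Qed.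

Lemma lt_total m n : m < n \/ m = n \/ n < m.
Proof.
  induct m.
  - destruct (zero_or_succ n) as [->|[m ->]]; auto using lt_0_succ.
  - intros m [[z ->]%lt_ex|[->|H]].
    + destruct (zero_or_succ z) as [->|[w ->]].
      * right; left; ring.
      * left; apply lt_ex; exists w; ring.
    + right; right; apply lt_succ; auto.
    + right; right; apply lt_succ; auto.
Qed.

Lemma lt_add_compat m n p q : m < p -> n < q -> m + n < p + q.
Proof.
  intros [a ->]%lt_ex [b ->]%lt_ex; apply lt_ex; exists (a + b + 1); ring.
Qed.

Lemma lt_add_r m n p : m < n -> m < n + p.
Proof. intros [a ->]%lt_ex; apply lt_ex; exists (a + p); ring. Qed.

Lemma lt_add_l m n p : m < n -> m < p + n.
Proof. intros [a ->]%lt_ex; apply lt_ex; exists (a + p); ring. Qed.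

Lemma lt_self_succ n : n < n + 1.
Proof. apply lt_succ; auto. Qed.

Lemma lt_succ_trans m n p : m < n + 1 -> n < p -> m < p.
Proof. intros [H| ->]%lt_succ H'; eauto using lt_trans. Qed.

Lemma lt_succ_le m n p : m < n + 1 -> n < p + 1 -> m < p + 1.
Proof. intros H [H'| ->]%lt_succ; eauto using lt_succ_trans, lt_trans, lt_self_succ. Qed.

(** * Cantor pairing *)

(** With $s = i + j$ the code is at most $s^2 + s$, which is below $(s+1)^2$. *)
Lemma pair_lt i j i' j' : i + j < i' + j' -> pr i j < pr i' j'.
Proof.
  intros [z Hz]%lt_ex; unfold pairM; rewrite Hz; apply lt_ex.
  exists (i + j + j + (1 + 1) * (i + j) * z + z * z + (1 + 1) * z + i'); ring.
Qed.

Lemma add_cancel_l m n p : p + m = p + n -> m = n.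
Proof. rewrite !(add_comm p); apply add_cancel_r. Qed.

Lemma pair_inj i j i' j' : pr i j = pr i' j' -> i = i' /\ j = j'.
Proof.
  intros H; destruct (lt_total (i + j) (i' + j')) as [L|[E|L]].
  - apply pair_lt in L; rewrite H in L; now apply lt_irrefl in L.
  - unfold pairM in H; rewrite E in H; apply add_cancel_l in H; subst.
    split; [easy|]; now apply add_cancel_l in E.
  - apply pair_lt in L; rewrite H in L; now apply lt_irrefl in L.
Qed.

Lemma lt_pair_l i j : i < pr i j + 1.
Proof. apply lt_ex; exists ((i + j) * (i + j)); unfold pairM; ring. Qed.

Lemma lt_pair_r i j : j < pr i j + 1.
Proof.
  destruct (zero_or_succ (i + j)) as [E|[m E]].
  - apply lt_ex; exists (i * i + (1 + 1) * i * j + j * j + i).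
    enough (Hj : j = 0) by (rewrite Hj; unfold pairM; ring).
    destruct (zero_or_succ j) as [|[w ->]]; [easy|].
    rewrite add_1_assoc in E; now apply succ_neq_0 in E.
  - apply lt_ex; exists (m * m + m + i + i); unfold pairM.
    (* One copy of [m + 1] is turned back into [i + j], which replaces a subtraction. *)
    transitivity (m * m + m + (m + 1) + i + 1); [rewrite E|rewrite <- E]; ring.
Qed.

(** * Codes of finite sets by divisibility *)

(* The bound on the quotient keeps the formula bounded; it is correct only for
   [m <> 0], see [dv_succ]. *)
Definition dv (m a : D) : Prop := exists q, q < a + 1 /\ q * m = a.

Lemma dv_succ w a : dv (w + 1) a <-> exists q, q * (w + 1) = a.
Proof.
  split; [intros (q & _ & H); eauto|]; intros [q <-]; exists q; split; [|easy].
  apply lt_ex; exists (q * w); ring.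
Qed.

(** Divisibility of a difference, stated without subtraction: the quotient is [q1] minus [q2], and
    [q1 < q2] is impossible because the modulus is positive. *)
Lemma multiple_sub w q1 q2 c :
  q1 * (w + 1) = q2 * (w + 1) + c -> exists q, q * (w + 1) = c.
Proof.
  intros H; destruct (lt_total q1 q2) as [[z ->]%lt_ex|[->|[z ->]%lt_ex]].
  - exfalso; apply (succ_neq_0 (z * w + z + w + c)), (add_cancel_l _ _ (q1 * (w + 1))).
    rewrite add_0_r; rewrite H at 2; ring.
  - exists 0; rewrite mul_0_l; apply (add_cancel_l _ _ (q2 * (w + 1))).
    now rewrite <- H, add_0_r.
  - exists (z + 1); apply (add_cancel_l _ _ (q2 * (w + 1))).
    rewrite <- H; ring.
Qed.

(** The moduli of Goedel's beta function. *)
Definition modulus (b x : D) : D := (x + 1) * b + 1.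

(** The modulus is coprime to [b]: [c] is [c * modulus b x] minus [(x + 1) * (c * b)], and both are
    multiples of it. *)
Lemma modulus_cancel_base b x c q :
  q * modulus b x = c * b -> exists q', q' * modulus b x = c.
Proof.
  intros H; apply (multiple_sub _ c ((x + 1) * q)).
  transitivity ((x + 1) * (c * b) + c); [ring|].
  now rewrite <- H, mul_assoc.
Qed.

(* Two moduli differ by [d * b], and [d] divides [b], so they are coprime. *)
Lemma modulus_cancel b x y a d e q :
  b = e * d -> y = x + d \/ x = y + d ->
  q * modulus b x = a * modulus b y -> exists q', q' * modulus b x = a.
Proof.
  intros Hb Hd H.
  (* Up to sign, [a * d * b] is the difference of [a * modulus b y] and [a * modulus b x]. *)
  assert (H1 : exists r, r * modulus b x = a * d * b).
  { unfold modulus in *; destruct Hd as [->| ->].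
    - apply (multiple_sub _ q a); rewrite H; ring.
    - apply (multiple_sub _ a q); rewrite H; ring. }
  destruct H1 as [r1 H1]; apply modulus_cancel_base in H1 as [r2 H2].
  (* Multiplying by [e] turns [a * d] into [a * b], so that [b] cancels a second time. *)
  apply modulus_cancel_base with (q := r2 * e).
  transitivity (r2 * modulus b x * e); [ring|]; rewrite H2, Hb; ring.
Qed.

(** Built like a factorial; the bound on [e] keeps the matrix of the induction formula bounded. *)
Lemma common_multiple n :
  exists b, b <> 0 /\ forall i, i < n -> exists e, e < b + 1 /\ b = e * (i + 1).
Proof.
  pattern n; apply (ind_Sigma1 (fun n b => b <> 0 /\
    forall i, i < n -> exists e, e < b + 1 /\ b = e * (i + 1))); [def| |].
  - exists 1; split; [|intros i Hi; now apply nlt_0 in Hi].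
    rewrite <- (add_0_l 1); apply succ_neq_0.
  - clear n; intros n (b & Hb & H); destruct (zero_or_succ b) as [|[w ->]]; [easy|].
    exists ((w + 1) * (n + 1)); split.
    + replace ((w + 1) * (n + 1)) with (w * n + w + n + 1) by ring.
      apply succ_neq_0.
    + intros i [Hi| ->]%lt_succ.
      * destruct (H i Hi) as (e & _ & He); exists (e * (n + 1)).
        assert (E : (w + 1) * (n + 1) = e * (n + 1) * (i + 1))
          by (rewrite He at 1; ring).
        split; [|exact E]; rewrite E; apply lt_ex; exists (e * (n + 1) * i); ring.
      * exists (w + 1); split; [|easy]; apply lt_ex; exists ((w + 1) * n); ring.
Qed.

(** [a] is the product of the moduli of those elements of [P] below [n'] that are below [n];
    coprimality prevents other moduli from dividing it. *)
Lemma code_below (P : D -> Prop) n b :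
  Def1 P -> b <> 0 ->
  (forall i, i < n -> exists e, e < b + 1 /\ b = e * (i + 1)) ->
  forall n', exists a, forall x, x < n -> (dv (modulus b x) a <-> x < n' /\ P x).
Proof.
  intros HP Hb Hdiv; unfold modulus.
  apply (ind_Sigma1 (fun n' a => forall x, x < n ->
    (dv ((x + 1) * b + 1) a <-> x < n' /\ P x))); [unfold dv; def| |].
  (* The empty product: as [b] is nonzero every modulus is at least 2 and does not divide 1. *)
  - exists 1; intros x _; split; [|intros [H _]; now apply nlt_0 in H].
    rewrite dv_succ; intros [q Hq]; exfalso.
    destruct (zero_or_succ b) as [|[c ->]]; [easy|].
    destruct (zero_or_succ q) as [->|[r ->]].
    + rewrite mul_0_l in Hq; apply (succ_neq_0 0); now rewrite add_0_l.
    + apply (succ_neq_0 (r * (x * c + x + c + 1 + 1) + (x * c + x + c))).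
      apply succ_inj; rewrite add_0_l.
      transitivity ((r + 1) * ((x + 1) * (c + 1) + 1)); [ring|exact Hq].
  - intros n' [a Ha].
    destruct (classic (n' < n /\ P n')) as [[Hn HPn]|Hno].
    + exists (a * modulus b n'); intros x Hx.
      destruct (classic (x = n')) as [->|Hne].
      * split; [intros _; auto using lt_self_succ|]; intros _.
        apply dv_succ; now exists a.
      * rewrite lt_succ; transitivity (x < n' /\ P x); [|tauto].
        rewrite <- (Ha x Hx), !dv_succ; split; intros [q Hq].
        2: { exists (q * modulus b n'); rewrite <- Hq; ring. }
        (* The distance [z + 1] of [x] and [n'] divides [b] because [z < n], so the new factor
           cancels. *)
        destruct (lt_total x n') as [[z Hz]%lt_ex|[|[z Hz]%lt_ex]]; [|easy|].
        -- destruct (Hdiv z) as (e & _ & He).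
           { apply (lt_trans _ n'); [|easy]; apply lt_ex; exists x; rewrite Hz; ring. }
           apply (modulus_cancel b x n' a (z + 1) e q); auto.
        -- destruct (Hdiv z) as (e & _ & He).
           { apply (lt_trans _ x); [|easy]; apply lt_ex; exists n'; rewrite Hz; ring. }
           apply (modulus_cancel b x n' a (z + 1) e q); auto.
    + exists a; intros x Hx; rewrite (Ha x Hx), lt_succ.
      split; [tauto|]; intros [[H| ->] HPx]; tauto.
Qed.

(* A code is a triple (n, b, a), standing for the set of the [x < n] whose
   modulus divides [a]. *)
Definition elem (x s : D) : Prop :=
  exists n, n < s + 1 /\ exists b, b < s + 1 /\ exists a, a < s + 1 /\
    s = pr n (pr b a) /\ x < n /\ dv (modulus b x) a.

Lemma elem_def : Def2 elem.
Proof. unfold elem, dv, modulus; def. Qed.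

Ltac def_base ::=
  lazymatch goal with
  | |- D0 ?v (fun g => elem (@?a g) (@?b g)) => apply (elem_def _ v a b)
  end.

Lemma elem_lt x s : elem x s -> x < s.
Proof.
  intros (n & _ & b & _ & a & _ & -> & Hx & _).
  destruct (proj1 (lt_succ _ _) (lt_pair_l n (pr b a))) as [H|H].
  - eauto using lt_trans.
  - now rewrite H in Hx at 1.
Qed.

(** Bounded comprehension: finite sets become numbers, so a quantifier over them is a number
    quantifier and may occur in the induction formulas below. *)
Lemma coding (P : D -> Prop) n :
  Def1 P -> exists s, forall x, elem x s <-> x < n /\ P x.
Proof.
  intros HP; destruct (common_multiple n) as (b & Hb & Hdiv).
  destruct (code_below P n b HP Hb Hdiv n) as [a Ha].
  exists (pr n (pr b a)); intros x; split.
  - intros (n1 & _ & b1 & _ & a1 & _ & E & Hx & H).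
    apply pair_inj in E as [<- [<- <-]%pair_inj]; now apply Ha.
  - intros [Hx H]; exists n; split; [apply lt_pair_l|].
    assert (H1 := lt_pair_r n (pr b a)).
    exists b; split; [exact (lt_succ_le _ _ _ (lt_pair_l b a) H1)|].
    exists a; split; [exact (lt_succ_le _ _ _ (lt_pair_r b a) H1)|].
    repeat split; auto; now apply Ha.
Qed.

Lemma coding_pairs (P : D -> D -> Prop) n :
  Def2 P ->
  exists s, forall x y, elem (pr x y) s <-> x < n /\ y < n /\ P x y.
Proof.
  intros HP.
  destruct (coding (fun p => exists x, x < p + 1 /\ exists y, y < p + 1 /\
    p = pr x y /\ x < n /\ y < n /\ P x y) (pr n n)) as [s Hs]; [def|].
  exists s; intros x y; rewrite Hs; split.
  - intros (_ & x' & _ & y' & _ & [-> ->]%pair_inj & H); exact H.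
  - intros (Hx & Hy & H); split; [now apply pair_lt, lt_add_compat|].
    exists x; split; [apply lt_pair_l|]; exists y; split; [apply lt_pair_r|auto].
Qed.

(** * Collection principles *)

Lemma Sigma1_collection (Q : D -> D -> Prop) :
  Def2 Q -> (forall x, exists a, Q x a) ->
  forall y, exists c, forall x, x < y -> exists a, a < c /\ Q x a.
Proof.
  intros HQ H; apply (ind_Sigma1 (fun y c =>
    forall x, x < y -> exists a, a < c /\ Q x a)); [def| |].
  - exists 0; intros x Hx; now apply nlt_0 in Hx.
  - intros y [c Hc]; destruct (H y) as [a Ha]; exists (c + (a + 1)).
    intros x [Hx| ->]%lt_succ.
    + destruct (Hc x Hx) as (a' & Ha' & HQ'); exists a'; split; [|easy].
      now apply lt_add_r.
    + exists a; split; [apply lt_add_l, lt_self_succ|easy].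
Qed.

(** Monotonicity in [w] lets a single late stage refute all failing candidates [a < c] at once. *)
Lemma Sigma2_collection (Q : D -> D -> D -> Prop) :
  Def3 Q -> (forall x w w' a, w < w' -> Q x a w' -> Q x a w) ->
  (forall x, exists a, forall w, Q x a w) ->
  forall y, exists c, forall x, x < y -> exists a, a < c /\ forall w, Q x a w.
Proof.
  intros HQ Hmono H y.
  (* The left-hand form, with [w] outermost, is the one to which Sigma2 induction
     applies; Sigma1 collection shows that it is as strong as the intended one. *)
  assert (E : forall y c, (forall w, forall x, x < y -> exists a, a < c /\ Q x a w) ->
    forall x, x < y -> exists a, a < c /\ forall w, Q x a w).
  { intros y' c Hw x Hx; apply NNPP; intros Hno.
    (* If every [a < c] fails at some [w], these stages have a common bound [W], which contradicts
       the hypothesis at [W]. *)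
    destruct (Sigma1_collection (fun a w => a < c -> ~ Q x a w)) with (y := c)
      as [W HW]; [def| |].
    - intros a; apply NNPP; intros Ha; apply Hno; exists a.
      split; [apply NNPP; intros Hac|intros w; apply NNPP; intros HQ'];
        apply Ha; [exists 0; tauto|exists w; tauto].
    - destruct (Hw W x Hx) as (a & Hac & HQ').
      destruct (HW a Hac) as (w & HwW & Hn); apply (Hn Hac); eauto. }
  enough (H' : exists c, forall w, forall x, x < y -> exists a, a < c /\ Q x a w)
    by (destruct H' as [c Hc]; eauto).
  pattern y; apply (ind_Sigma2 (fun y c w =>
    forall x, x < y -> exists a, a < c /\ Q x a w)); [def| |].
  - exists 0; intros w x Hx; now apply nlt_0 in Hx.
  - clear y; intros y [c Hc]; destruct (H y) as [a Ha]; exists (c + (a + 1)).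
    intros w x [Hx| ->]%lt_succ.
    + destruct (E _ _ Hc x Hx) as (a' & Ha' & HQ'); exists a'; split; [|easy].
      now apply lt_add_r.
    + exists a; split; [apply lt_add_l, lt_self_succ|easy].
Qed.

(** * The pigeonhole principle *)

(* [f] codes a relation from {0, ..., j} to {0, ..., j-1}, not necessarily
   single-valued. *)
Definition total_injective (j f : D) : Prop :=
  (forall i, i < j + 1 -> exists c, c < j /\ elem (pr i c) f) /\
  (forall i, i < j + 1 -> forall i', i' < j + 1 -> forall c, c < j ->
     elem (pr i c) f -> elem (pr i' c) f -> i = i').

(** Arguments with the top value [j] are redirected to the values of the discarded argument
    [j + 1]. *)
Lemma total_injective_pred j f :
  total_injective (j + 1) f -> exists f', total_injective j f'.
Proof.
  intros [Htot Hinj].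
  destruct (coding_pairs (fun i c => elem (pr i c) f \/
    (elem (pr i j) f /\ elem (pr (j + 1) c) f)) (j + 1)) as [f' Hf']; [def|].
  assert (Hj := lt_self_succ j); assert (Hj1 := lt_self_succ (j + 1)).
  assert (up : forall x, x < j + 1 -> x < j + 1 + 1) by eauto using lt_trans.
  assert (up' : forall x, x < j -> x < j + 1) by eauto using lt_trans.
  assert (ne : forall i, i < j + 1 -> i <> j + 1)
    by (intros i Hi ->; now apply lt_irrefl in Hi).
  exists f'; split.
  - intros i Hi; destruct (Htot i (up _ Hi)) as (c & [Hc| ->]%lt_succ & Hic).
    + exists c; split; [easy|]; apply Hf'; auto.
    + destruct (Htot (j + 1) Hj1) as (c & [Hc| ->]%lt_succ & Hjc).
      * exists c; split; [easy|]; apply Hf'; auto.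
      * exfalso; apply (ne i Hi); eauto.
  - intros i Hi i' Hi' c Hc (_ & _ & H)%Hf' (_ & _ & H')%Hf'.
    destruct H as [H|[H1 H2]], H' as [H'|[H1' H2']].
    + eauto.
    + exfalso; apply (ne i Hi); eauto.
    + exfalso; apply (ne i' Hi'); eauto.
    + eauto.
Qed.

(** Descent from [k] to an empty range, written as an upward induction on [x] with [j + x = k]. The
    code is quantified existentially, and [k < x] absorbs the steps after the end. *)
Lemma pigeonhole k f : ~ total_injective k f.
Proof.
  intros Hf.
  destruct (ind_Sigma1 (fun x f => k < x \/
    exists j, j < k + 1 /\ j + x = k /\ total_injective j f)) with (x := k)
    as (f' & [H|(j & _ & Hj & [H _])]); [unfold total_injective; def| | | |].
  - exists f; right; exists k; auto using lt_self_succ, add_0_r.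
  - intros x (f' & [H|(j & Hj & E & Hf')]).
    { exists f'; left; apply lt_succ; auto. }
    destruct (zero_or_succ j) as [->|[i ->]].
    + exists f'; left; rewrite <- E, add_0_l; apply lt_self_succ.
    + destruct (total_injective_pred _ _ Hf') as [f'' Hf'']; exists f''; right.
      exists i; repeat split; try apply Hf''.
      * eauto using lt_trans, lt_self_succ.
      * rewrite <- E; ring.
  - now apply lt_irrefl in H.
  - assert (j = 0) as ->.
    { apply (add_cancel_r _ _ k); now rewrite Hj, add_0_l. }
    destruct (H 0) as (c & Hc & _); [apply lt_0_succ|now apply nlt_0 in Hc].
Qed.

(** * The colouring and the equivalence of elements *)

Variables (k : D) (O C : D -> Prop).
Hypothesis HO : sets M O.
Hypothesis HC : sets M C.
Hypothesis O_total : forall a b, a < k -> b < k ->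
  exists c, c < k /\ code3 M O a b c /\
    forall c', c' < k -> code3 M O a b c' -> c' = c.
Hypothesis C_total : forall i j, i < j ->
  exists c, c < k /\ code3 M C i j c /\
    forall c', c' < k -> code3 M C i j c' -> c' = c.
Hypothesis C_additive : forall i j l a b c, i < j -> j < l ->
  a < k -> b < k -> c < k ->
  code3 M C i j a -> code3 M C j l b -> code3 M C i l c -> code3 M O a b c.

Lemma colour_unique i j c c' :
  i < j -> c < k -> c' < k -> code3 M C i j c -> code3 M C i j c' -> c = c'.
Proof.
  intros H Hc Hc' E E'; destruct (C_total i j H) as (d & _ & _ & U).
  transitivity d; [|symmetry]; auto.
Qed.

Definition agree (x y m : D) : Prop :=
  exists c, c < k /\ code3 M C x m c /\ code3 M C y m c.

Definition equiv (x y : D) : Prop := exists m, x < m /\ y < m /\ agree x y m.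

Ltac def_base ::=
  lazymatch goal with
  | |- D0 ?v (fun g => elem (@?a g) (@?b g)) => apply (elem_def _ v a b)
  | |- D0 _ (fun g => agree _ _ _) => unfold agree
  end.

Lemma agree_sym x y m : agree x y m -> agree y x m.
Proof. intros (c & ? & ? & ?); now exists c. Qed.

Lemma agree_trans x y z m : y < m -> agree x y m -> agree y z m -> agree x z m.
Proof.
  intros H (c & Hc & Hx & Hy) (c' & Hc' & Hy' & Hz); exists c.
  repeat split; auto; now rewrite (colour_unique y m c c').
Qed.

(** By additivity both colours at [m'] are the common colour at [m] times [C(m,m')]. *)
Lemma agree_mono x y m m' :
  x < m -> y < m -> m < m' -> agree x y m -> agree x y m'.
Proof.
  intros Hx Hy Hm (c & Hc & Cx & Cy).
  destruct (C_total m m' Hm) as (d & Hd & Cd & _).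
  destruct (C_total x m') as (e & He & Ex & _); [eauto using lt_trans|].
  destruct (C_total y m') as (e' & He' & Ey & _); [eauto using lt_trans|].
  destruct (O_total c d Hc Hd) as (p & _ & _ & U).
  exists e; repeat split; auto.
  replace e with e'; [easy|].
  transitivity p; [|symmetry]; eauto.
Qed.

Lemma equiv_sym x y : equiv x y -> equiv y x.
Proof. intros (m & Hx & Hy & H); exists m; auto using agree_sym. Qed.

Lemma equiv_trans x y z : equiv x y -> equiv y z -> equiv x z.
Proof.
  intros (m & Hx & Hy & H) (m' & Hy' & Hz & H').
  assert (L : m < m + m' + 1) by (apply lt_ex; exists m'; ring).
  assert (L' : m' < m + m' + 1) by (apply lt_ex; exists m; ring).
  exists (m + m' + 1); repeat split; eauto using lt_trans.
  apply agree_trans with y; eauto using lt_trans, agree_mono.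
Qed.

(** * A finite system of representatives *)

(* [s] codes a sequence of length [t] which is pairwise inequivalent as far as
   stage [m] can tell. *)
Definition transversal (s t m : D) : Prop :=
  (forall i, i < t -> exists z, z < s /\ elem (pr i z) s) /\
  (forall i, i < t -> forall i', i' < t -> forall z, z < m -> forall z', z' < m ->
     elem (pr i z) s -> elem (pr i' z') s -> ~ (i = i' /\ z = z') ->
     ~ agree z z' m).

Lemma elem_pair_lt i z s : elem (pr i z) s -> z < s.
Proof. intros H%elem_lt; eauto using lt_succ_trans, lt_pair_r. Qed.

(** All members lie below the code [s], so they can be compared at stage [s]; there their colours
    would inject [k + 1] positions into [k] colours. *)
Lemma no_long_transversal s : ~ forall m, transversal s (k + 1) m.
Proof.
  intros H; destruct (H s) as [Htot Hne].
  destruct (coding_pairs (fun i c => exists z, z < s /\ elem (pr i z) s /\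
    code3 M C z s c) (k + 1)) as [f Hf]; [def|].
  apply (pigeonhole k f); split.
  - intros i Hi; destruct (Htot i Hi) as (z & Hz & Hiz).
    destruct (C_total z s Hz) as (c & Hc & HCc & _); exists c; split; [easy|].
    apply Hf; repeat split; eauto using lt_trans, lt_self_succ.
  - intros i Hi i' Hi' c Hc (_ & _ & z & Hz & Hiz & E)%Hf
      (_ & _ & z' & Hz' & Hiz' & E')%Hf.
    apply NNPP; intros Hii.
    apply (Hne i Hi i' Hi' z Hz z' Hz' Hiz Hiz'); [tauto|now exists c].
Qed.

Lemma transversal_extend s t x :
  (forall m, transversal s t m) ->
  (forall i z, i < t -> elem (pr i z) s -> ~ equiv x z) ->
  exists s', forall m, transversal s' (t + 1) m.
Proof.
  (* [n] exceeds every position up to [t], every member of [s], and [x]. *)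
  intros Hs Hx; set (n := t + s + x + 1).
  destruct (coding_pairs (fun i z => (i < t /\ elem (pr i z) s) \/
    (i = t /\ z = x)) n) as [s' Hs']; [def|].
  exists s'; intros m; destruct (Hs m) as [Htot Hne]; split.
  - intros i Hi.
    assert (Hin : i < n).
    { eapply lt_succ_le; [exact Hi|]; apply lt_ex; exists (s + x); unfold n; ring. }
    enough (H : exists z, elem (pr i z) s') by
      (destruct H as [z Hz]; eauto using elem_pair_lt).
    apply lt_succ in Hi as [Hi| ->].
    + destruct (Htot i Hi) as (z & Hz & Hiz); exists z; apply Hs'.
      repeat split; auto; unfold n; now apply lt_add_r, lt_add_r, lt_add_l.
    + exists x; apply Hs'; repeat split; auto.
      apply lt_ex; exists (t + s); unfold n; ring.
  - intros i _ i' _ z Hz z' Hz' (_ & _ & H)%Hs' (_ & _ & H')%Hs' Hd Hag.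
    destruct H as [[Hi H]|[-> ->]], H' as [[Hi' H']|[-> ->]].
    + now apply (Hne i Hi i' Hi' z Hz z' Hz').
    + apply (Hx i z Hi H); exists m; auto using agree_sym.
    + apply (Hx i' z' Hi' H'); exists m; auto.
    + tauto.
Qed.

(** If no transversal met every class, each could be extended, and induction would produce one of
    length [k + 1]. *)
Lemma representatives :
  exists (R : D -> Prop) s, Def1 R /\ (forall z, R z -> z < s) /\
    (forall x, exists z, R z /\ equiv x z) /\
    (forall z z', R z -> R z' -> z <> z' -> ~ equiv z z').
Proof.
  destruct (classic (exists t s, (forall m, transversal s t m) /\
    forall x, exists i z, i < t /\ elem (pr i z) s /\ equiv x z))
    as [(t & s & Hs & Hcov)|Hno].
  - exists (fun z => exists i, i < t /\ elem (pr i z) s), s.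
    split; [def|split; [|split]].
    + intros z (i & _ & Hz); eauto using elem_pair_lt.
    + intros x; destruct (Hcov x) as (i & z & ? & ? & ?); eauto.
    + intros z z' (i & Hi & H) (i' & Hi' & H') Hzz (m & Hz & Hz' & Hag).
      destruct (Hs m) as [_ Hne].
      apply (Hne i Hi i' Hi' z Hz z' Hz' H H'); tauto.
  - exfalso.
    (* Inequivalence is $\Pi^0_1$, so the existence of a transversal of length [t] is
       $\Sigma^0_2$. *)
    destruct (ind_Sigma2 (fun t s m => transversal s t m)) with (x := k + 1)
      as [s Hs]; [unfold transversal; def| | |exact (no_long_transversal s Hs)].
    + exists 0; intros m; split; intros i Hi; now apply nlt_0 in Hi.
    + intros t [s Hs]; apply NNPP; intros Hn; apply Hno; exists t, s.
      split; [easy|]; intros x; apply NNPP; intros Hx; apply Hn.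
      apply (transversal_extend s t x Hs); intros i z Hi Hz He; apply Hx; eauto.
Qed.

(** * An infinite part of one class with one colour *)

(** Otherwise each pair of a representative and a colour has a bound on its elements, and collection
    makes these bounds uniform. *)
Lemma infinite_class (R : D -> Prop) s :
  Def1 R -> (forall z, R z -> z < s) -> (forall x, exists z, R z /\ equiv x z) ->
  exists z a, R z /\ a < k /\ forall n, exists x, n < x /\
    z < x /\ code3 M C z x a /\ equiv x z.
Proof.
  intros HR Hs Hcov; apply NNPP; intros Hno.
  (* [e] codes the pair [(z, a)] and [n] is its bound; [w] limits both [x] and the stage [m], so the
     matrix is bounded and monotone. *)
  destruct (Sigma2_collection (fun e n w => forall z, z < e + 1 ->
    forall a, a < e + 1 -> e = pr z a -> R z -> a < k ->
    forall x, x < w -> forall m, m < w -> n < x -> z < x -> x < m ->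
    code3 M C z x a -> ~ agree x z m)) with (y := pr s k) as [c Hc]; [def| | |].
  - intros e w w' n Hw H z Hz a Ha E Rz Hak x Hx m Hm.
    apply (H z Hz a Ha E Rz Hak); eauto using lt_trans.
  - intros e; destruct (classic (exists z a, e = pr z a /\ R z /\ a < k))
      as [(z & a & -> & Hz & Ha)|Hn].
    + apply NNPP; intros Hn; apply Hno; exists z, a; split; [easy|split; [easy|]].
      intros n; apply NNPP; intros Hx; apply Hn; exists n.
      intros w z' _ a' _ [<- <-]%pair_inj _ _ x _ m _ Hnx Hzx Hxm Hcol Hag.
      apply Hx; exists x; repeat split; auto; exists m; eauto using lt_trans.
    + exists 0; intros w z _ a _ E Rz Ha; exfalso; apply Hn; eauto.
  (* The element [c + s] lies above all the bounds and all the representatives. *)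
  - destruct (Hcov (c + s)) as (z & Rz & m & Hxm & Hzm & Hag).
    assert (Hz : z < c + s) by auto using lt_add_l.
    destruct (C_total z (c + s) Hz) as (a & Ha & Hcol & _).
    destruct (Hc (pr z a)) as (n & Hn & H); [auto using pair_lt, lt_add_compat|].
    apply (H (m + 1) z (lt_pair_l _ _) a (lt_pair_r _ _) eq_refl Rz Ha
      (c + s)) with (m := m); auto using lt_add_r, lt_self_succ.
Qed.

(** * The greedy homogeneous set *)

(** [u] is an approximation: it obeys the recursion below [x] and is arbitrary from [x] on. *)
Definition greedy (J : D -> Prop) (a u x : D) : Prop :=
  forall y, y < x ->
    (elem y u <-> J y /\ forall i, i < y -> elem i u -> code3 M C i y a).

Lemma greedy_exists J a : sets M J -> forall x, exists u, greedy J a u x.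
Proof.
  intros HJ; apply (ind_Sigma1 (fun x u => greedy J a u x)); [unfold greedy; def| |].
  - exists 0; intros y Hy; now apply nlt_0 in Hy.
  - intros x [u Hu].
    (* The new code copies [u] below [x] and decides [x] itself. *)
    destruct (coding (fun y => (y < x /\ elem y u) \/ (y = x /\ J y /\
      forall i, i < x -> elem i u -> code3 M C i x a)) (x + 1)) as [u' Hu']; [def|].
    assert (E : forall y, y < x -> (elem y u' <-> elem y u)).
    { intros y Hy; rewrite Hu', lt_succ; split; [|tauto].
      intros [_ [[_ H]|[-> _]]]; [easy|now apply lt_irrefl in Hy]. }
    exists u'; intros y [Hy| ->]%lt_succ.
    + rewrite (E y Hy), (Hu y Hy); split; intros [H1 H2]; (split; [easy|]);
        intros i Hi Hi'; apply H2; auto; apply E; eauto using lt_trans.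
    + rewrite Hu'; split.
      * intros [_ [[H _]|(_ & H1 & H2)]]; [now apply lt_irrefl in H|].
        split; [easy|]; intros i Hi Hi'; apply H2; auto; now apply E.
      * intros [H1 H2]; split; [apply lt_self_succ|]; right; repeat split; auto.
        intros i Hi Hi'; apply H2; auto; now apply E.
Qed.

(** Course-of-values induction, since membership of [y] depends on all smaller elements. *)
Lemma greedy_unique J a u u' x :
  greedy J a u x -> greedy J a u' x -> forall y, y < x -> (elem y u <-> elem y u').
Proof.
  intros H H' y Hy.
  enough (A : forall n y, y < n -> y < x -> (elem y u <-> elem y u'))
    by exact (A (y + 1) y (lt_self_succ y) Hy).
  clear y Hy; apply (ind_D0 (fun n => forall y, y < n -> y < x ->
    (elem y u <-> elem y u'))); [def|intros y Hy; now apply nlt_0 in Hy|].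
  intros n IH y [Hy| ->]%lt_succ Hyx; [auto|].
  rewrite (H n Hyx), (H' n Hyx); split; intros [H1 H2]; (split; [easy|]);
    intros i Hi Hi'; apply H2; auto; apply IH; eauto using lt_trans.
Qed.

(** Approximations exist and are unique below their length, so membership in some approximation and
    in all of them coincide; this gives a $\Delta^0_1$ definition. *)
Lemma greedy_set J a : sets M J ->
  exists I, sets M I /\
    forall y, I y <-> J y /\ forall i, i < y -> I i -> code3 M C i y a.
Proof.
  intros HJ.
  destruct (comprehension (fun y => exists u, greedy J a u (y + 1) /\ elem y u)
    (fun y u => greedy J a u (y + 1) /\ elem y u)
    (fun y u => greedy J a u (y + 1) -> elem y u)) as (I & HI & EI);
    [unfold greedy; def|unfold greedy; def|easy| |].
  - intros y; split.
    + intros (u & Hu & Hy) u' Hu'.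
      apply (greedy_unique J a u u' _ Hu Hu' y (lt_self_succ y)), Hy.
    + intros H; destruct (greedy_exists J a HJ (y + 1)) as [u Hu]; eauto.
  - assert (E : forall u x y, greedy J a u x -> y < x -> (I y <-> elem y u)).
    { intros u x y Hu Hy.
      assert (Hu1 : greedy J a u (y + 1)).
      { intros w Hw; apply Hu; eauto using lt_succ_trans. }
      rewrite EI; split; [|eauto]; intros (u' & Hu' & H).
      apply (greedy_unique J a u' u _ Hu' Hu1 y (lt_self_succ y)), H. }
    exists I; split; [easy|]; intros y.
    destruct (greedy_exists J a HJ (y + 1)) as [u Hu].
    assert (Hy := lt_self_succ y).
    rewrite (E u (y + 1) y Hu Hy), (Hu y Hy).
    split; intros [H1 H2]; (split; [easy|]); intros i Hi Hi'; apply H2; auto;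
      apply (E u (y + 1) i Hu); eauto using lt_trans.
Qed.

Lemma homogeneous_in_class J z a : sets M J ->
  (forall n, exists x, n < x /\ J x) ->
  (forall x, J x -> z < x /\ code3 M C z x a /\ equiv x z) -> a < k ->
  exists I, sets M I /\ (forall n, exists m, n < m /\ I m) /\
    forall i j, I i -> I j -> i < j -> code3 M C i j a.
Proof.
  intros HJ Jinf HJz Ha; destruct (greedy_set J a HJ) as (I & HI & EI).
  exists I; split; [easy|split].
  - intros n; apply NNPP; intros Hn.
    (* If [I] has no element above [n], one bound [c] covers the stages at which its elements come
       to agree with [z]. *)
    destruct (Sigma1_collection (fun i m => I i -> i < m /\ z < m /\ agree i z m))
      with (y := n + 1) as [c Hc]; [def| |].
    { intros i; destruct (classic (I i)) as [Hi|Hi]; [|exists 0; tauto].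
      destruct (HJz i (proj1 (proj1 (EI i) Hi))) as (_ & _ & m & H); eauto. }
    destruct (Jinf (n + c)) as (y & Hy & Jy).
    destruct (HJz y Jy) as (Hzy & Czy & _).
    assert (Hny : n < y).
    { eapply lt_succ_trans; [|exact Hy]; apply lt_ex; exists c; ring. }
    apply Hn; exists y; split; [easy|]; apply EI; split; [easy|].
    intros i Hi Ii.
    assert (Hin : i < n + 1).
    { destruct (lt_total i (n + 1)) as [|[->|H]]; [easy| |]; exfalso; apply Hn.
      - exists (n + 1); split; [apply lt_self_succ|easy].
      - exists i; split; [|easy]; eauto using lt_trans, lt_self_succ. }
    destruct (Hc i Hin) as (m & Hm & H); destruct (H Ii) as (Him & Hzm & Hag).
    assert (Hmy : m < y) by eauto using lt_trans, lt_add_l.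
    (* The agreement persists up to [y], where [z] has colour [a]. *)
    destruct (agree_mono i z m y Him Hzm Hmy Hag) as (d & Hd & Ci & Cz).
    now rewrite (colour_unique z y a d).
  - intros i j Ii Ij Hij; apply EI; auto.
Qed.

(** * Combining the class and the greedy set *)

Lemma additive_ramsey :
  exists I, sets M I /\ (forall n, exists m, n < m /\ I m) /\
    exists a, a < k /\ forall i j, I i -> I j -> i < j -> code3 M C i j a.
Proof.
  destruct representatives as (R & s & HR & Hs & Hcov & Hne).
  destruct (infinite_class R s HR Hs Hcov) as (z & a & Rz & Ha & Hinf).
  destruct (comprehension (fun x => z < x /\ code3 M C z x a /\ equiv x z)
    (fun x m => z < x /\ code3 M C z x a /\ x < m /\ agree x z m)
    (* The $\Pi^0_1$ form: [x] agrees with no other representative at any stage. *)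
    (fun x m => z < x /\ code3 M C z x a /\ forall z', z' < s -> R z' -> z' <> z ->
       x < m -> z' < m -> ~ agree x z' m)) as (J & HJ & EJ); [def|def| | |].
  - intros x; split.
    + intros (Hz & Hc & m & Hm & _ & Hag); eauto.
    + intros (m & Hz & Hc & Hm & Hag); repeat split; auto.
      exists m; eauto using lt_trans.
  - intros x; split.
    + intros (Hz & Hc & He) m; repeat split; auto.
      intros z' _ Rz' Hzz Hm Hm' Hag; apply (Hne z z' Rz Rz'); [congruence|].
      apply equiv_trans with x; [now apply equiv_sym|]; now exists m.
    (* The first two conjuncts do not depend on the stage, so stage 0 yields them. *)
    + intros H; destruct (H 0) as (Hz & Hc & _); repeat split; auto.
      destruct (Hcov x) as (z' & Rz' & He).
      destruct (classic (z' = z)) as [->|Hzz]; [easy|exfalso].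
      destruct He as (m & Hxm & Hzm & Hag).
      destruct (H m) as (_ & _ & H'); apply (H' z'); auto.
  - destruct (homogeneous_in_class J z a HJ) as (I & HI & Iinf & Ihom); auto.
    + intros n; destruct (Hinf n) as (x & Hx & H); exists x; split; [easy|].
      now apply EJ.
    + intros x; apply EJ.
    + exists I; eauto.
Qed.

End Model.

Theorem mainTheorem3 :
  forall M : L2str, RCA0 M -> Sigma02_IND M -> AdditiveRamsey M.
Proof.
  intros M (HB & HS1 & HCA) HS2 k O C HO HC O_total _ C_total C_additive.
  (* The first [O] serves as the default set [X0] of the environments. *)
  exact (additive_ramsey M HB HS1 HCA HS2 O HO k O C HC O_total C_total C_additive).
Qed.
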